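(* Let $G$ be a maximal $K_4$-minor free graph of order $n\geq 3$. Then $\gamma_{\times 2}(G)\leq \lfloor \frac{2n}{3}\rfloor$. *)

(* Defs.v *)
From mathcomp Require Import all_boot.
Set Implicit Arguments. Unset Strict Implicit. Unset Printing Implicit Defensive.

Section Graphs.
Variable T : finType.

Definition simple_graph (e : rel T) : Prop := symmetric e /\ irreflexive e.

Definition induced_connected (e : rel T) (B : {set T}) : Prop :=
  B != set0 /\
  forall x y, x \in B -> y \in B ->
    connect [rel u v | [&& e u v, u \in B & v \in B]] x y.

Definition has_K_minor (n : nat) (e : rel T) : Prop :=
  exists B : 'I_n -> {set T},
    (forall i, induced_connected e (B i)) /\
    (forall i j, i != j -> [disjoint B i & B j]) /\
    (forall i j, i != j -> exists x y, [/\ x \in B i, y \in B j & e x y]).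

Definition K4_minor_free (e : rel T) : Prop := ~ has_K_minor 4 e.

Definition add_edge (e : rel T) (u v : T) : rel T :=
  fun x y => [|| e x y, (x == u) && (y == v) | (x == v) && (y == u)].

Definition maximal_K4_minor_free (e : rel T) : Prop :=
  K4_minor_free e /\
  forall u v, u != v -> ~~ e u v -> has_K_minor 4 (add_edge e u v).

Definition closed_nbhd (e : rel T) (v : T) : {set T} := [set u | (u == v) || e v u].

Definition double_dominating (e : rel T) (S : {set T}) : bool :=
  [forall v, 2 <= #|closed_nbhd e v :&: S|].

(* Double domination number: minimum size of a double dominating set
   (default #|T| if none exists). *)
Definition double_domination_number (e : rel T) : nat :=
  \big[minn/#|T|]_(S : {set T} | double_dominating e S) #|S|.

End Graphs.

(* Main.v *)
(** A graph of minimum degree three has a K4 minor: in a minor-minimal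
counterexample no edge can be contracted, so every edge lies in a triangle with
a vertex of degree three or joins two vertices of degree three with the same
other neighbours, and a local analysis excludes both cases.  Hence a
K4-minor-free graph is built by repeatedly attaching a vertex of degree at most
two, so it is a spanning subgraph of a 2-tree; as 2-trees are K4-minor-free, a
maximal K4-minor-free graph is a 2-tree.  A 2-tree on at least three vertices is
3-colourable and each vertex lies in a triangle, which meets every colour.  So
the union of two colour classes is double dominating, and the two smallest
classes have together at most two thirds of the vertices. *)

Require Import Defs.
From mathcomp Require Import all_boot zify.
Set Implicit Arguments. Unset Strict Implicit. Unset Printing Implicit Defensive.

(** * Minor models inside a vertex set *)

(* Connectivity through cuts: unlike paths, cuts pull back along contractions. *)
Definition cut_connected (T : finType) (e : rel T) (B : {set T}) : Prop :=
  B != set0 /\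
  forall (S : {set T}) x y, x \in B -> x \in S -> y \in B -> y \notin S ->
    exists u v, [/\ u \in B, u \in S, v \in B, v \notin S & e u v].

(** From cuts to paths, the cut to use is the set of vertices reachable from [x] inside [B].
    Conversely, a path that starts in [S] and ends outside [S] has an edge leaving [S]. *)
Lemma cut_connectedP (T : finType) (e : rel T) (B : {set T}) :
  cut_connected e B <-> induced_connected e B.
Proof.
split=> -[B0 cB]; split=> //.
  move=> x y xB yB; set r := (X in connect X); apply/negPn/negP => nxy.
  have [||u [v [uB]]] := cB [set z | connect r x z] x y xB _ yB.
  - by rewrite inE connect0.
  - by rewrite inE.
  rewrite !inE => xu vB /negP nv euv; apply: nv.
  by apply: (connect_trans xu); apply: connect1; rewrite /r /= euv uB.
move=> S x y xB xS yB yS.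
set r := [rel u v | [&& e u v, u \in B & v \in B]].
have [|nex] := boolP [exists u, exists v,
    [&& u \in B, u \in S, v \in B, v \notin S & e u v]].
  by move=> /existsP[u /existsP[v /and5P[]]]; exists u, v.
have /connectP[p] := cB x y xB yB.
elim: p x xS {xB} => [|z p IHp] x xS /= => [_ yx|/andP[/and3P[exz xB zB] zp]].
  by rewrite yx xS in yS.
apply: (IHp z) => //; apply/negPn/negP => zS; case/negP: nex.
by apply/existsP; exists x; apply/existsP; exists z; rewrite xB xS zB zS exz.
Qed.

Lemma cut_connected1 (T : finType) (e : rel T) (x : T) :
  cut_connected e [set x].
Proof.
split=> [|S y z]; first by apply/set0Pn; exists x; rewrite set11.
by rewrite !inE => /eqP-> xS /eqP->; rewrite xS.
Qed.

Lemma cut_connected2 (T : finType) (e : rel T) (x y : T) :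
  symmetric e -> e x y -> cut_connected e [set x; y].
Proof.
move=> esym exy; split=> [|S u v uB uS vB vS].
  by apply/set0Pn; exists x; rewrite !inE eqxx.
exists u, v; split=> //; move: uB vB uS vS.
by rewrite !inE => /orP[]/eqP-> /orP[]/eqP-> => [->|//||->] //; rewrite esym.
Qed.

(** The bags are confined to [U] so that inductions can delete vertices without changing the
    type. *)
Definition K4_minor_in (T : finType) (U : {set T}) (e : rel T) : Prop :=
  exists B : 'I_4 -> {set T},
    [/\ forall i, B i \subset U,
        forall i, cut_connected e (B i),
        forall i j x, x \in B i -> x \in B j -> i = j
      & forall i j, i != j -> exists x y, [/\ x \in B i, y \in B j & e x y]].

Lemma K4_minor_inT (T : finType) (e : rel T) :
  K4_minor_in [set: T] e <-> has_K_minor 4 e.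
Proof.
split=> [[B [_ cB dB aB]]|[B [cB [dB aB]]]]; exists B; split=> //.
- by move=> i; apply/cut_connectedP.
- split=> // i j nij; rewrite disjoint_subset; apply/subsetP => x xi.
  by rewrite inE; apply/negP => xj; rewrite (dB _ _ _ xi xj) eqxx in nij.
- by move=> i; apply/cut_connectedP.
move=> i j x xi xj; apply/eqP/negPn/negP => nij.
by have /disjointFr/(_ xi) := dB _ _ nij; rewrite xj.
Qed.

(** Minor models compose: [F] models [e] on [U] inside [e'] on [U'], and each bag of the given model
    is replaced by the union of the [F x] over its vertices [x]. *)
Lemma K4_minor_trans (T : finType) (e e' : rel T) (U U' : {set T})
    (F : T -> {set T}) :
  (forall x, x \in U -> F x \subset U') ->
  (forall x, x \in U -> cut_connected e' (F x)) ->
  (forall x y z, x \in U -> y \in U -> z \in F x -> z \in F y -> x = y) ->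
  (forall x y, x \in U -> y \in U -> e x y ->
     exists u v, [/\ u \in F x, v \in F y & e' u v]) ->
  K4_minor_in U e -> K4_minor_in U' e'.
Proof.
move=> sF cF dF aF [B [sB cB dB aB]].
have BU i x : x \in B i -> x \in U by apply/subsetP.
exists (fun i => \bigcup_(x in B i) F x); split.
- by move=> i; apply/bigcupsP => x /BU; apply: sF.
- move=> i; have [/set0Pn[b bB] cutB] := cB i; split.
    have [/set0Pn[c cb] _] := cF _ (BU _ _ bB).
    by apply/set0Pn; exists c; apply/bigcupP; exists b.
  move=> S x y /bigcupP[b1 b1B xb1] xS /bigcupP[b2 b2B yb2] yS.
  (* Either [S] cuts through a single [F c], whose own connectivity gives the crossing edge, or each
     [F c] lies inside or outside [S], and [S] pulls back to a cut of [B i]. *)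
  have [/existsP[d /and3P[dBi]]|nsplit] := boolP [exists c,
      [&& c \in B i, F c :&: S != set0 & F c :\: S != set0]].
    move=> /set0Pn[p /setIP[pb pS]] /set0Pn[q /setDP[qb qS]].
    have [_ /(_ S p q)] := cF _ (BU _ _ dBi).
    move=> /(_ pb pS qb qS)[u [v [ub uS vb vS euv]]].
    by exists u, v; split=> //; apply/bigcupP; exists d.
  have whole d : d \in B i -> F d :&: S != set0 -> F d \subset S.
    move=> dB' dS; rewrite -setD_eq0; apply/negPn/negP => dnS.
    by case/negP: nsplit; apply/existsP; exists d; rewrite dB' dS.
  have [||u [v]] := cutB [set b | F b \subset S] b1 b2 b1B _ b2B.
  - by rewrite inE whole //; apply/set0Pn; exists x; rewrite inE xb1.
  - by rewrite inE; apply/negP => /subsetP/(_ _ yb2); apply/negP.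
  rewrite !inE => -[uB uS vB vS euv].
  have [p [q [pu qv epq]]] := aF _ _ (BU _ _ uB) (BU _ _ vB) euv.
  exists p, q; split=> //.
  + by apply/bigcupP; exists u.
  + by move/subsetP: uS; apply.
  + by apply/bigcupP; exists v.
  + apply/negP => qS; case/negP: vS; apply: whole => //.
    by apply/set0Pn; exists q; rewrite inE qv.
- move=> i j x /bigcupP[b bB xb] /bigcupP[c cC xc].
  have bc := dF _ _ _ (BU _ _ bB) (BU _ _ cC) xb xc.
  by apply: (dB _ _ b) => //; rewrite bc.
- move=> i j /aB[x [y [xi yj exy]]].
  have [u [v [ux vy euv]]] := aF _ _ (BU _ _ xi) (BU _ _ yj) exy.
  by exists u, v; split=> //; apply/bigcupP; [exists x | exists y].
Qed.

Lemma K4_minor_sub (T : finType) (e e' : rel T) (U U' : {set T}) :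
  U \subset U' ->
  (forall x y, x \in U -> y \in U -> e x y -> e' x y) ->
  K4_minor_in U e -> K4_minor_in U' e'.
Proof.
move=> /subsetP sU ee'; apply: (@K4_minor_trans _ _ _ _ _ (fun x => [set x])).
- by move=> x /sU xU; rewrite sub1set.
- by move=> x _; apply: cut_connected1.
- by move=> x y z _ _; rewrite !inE => /eqP-> /eqP->.
- by move=> x y xU yU exy; exists x, y; rewrite !set11 ee'.
Qed.

(** An edge of [e] that is missing in [e'] is realized through [v], so it suffices to enlarge [u] to
    the branch set [[set u; v]] and keep all other vertices as singletons. *)
Lemma K4_minor_contract (T : finType) (e e' : rel T) (U : {set T}) (u v : T) :
  symmetric e' -> u \in U -> v \notin U -> e' u v ->
  (forall x y, x \in U -> y \in U -> e x y ->
     [\/ e' x y, x = u /\ e' v y | y = u /\ e' x v]) ->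
  K4_minor_in U e -> K4_minor_in (v |: U) e'.
Proof.
move=> e'sym uU vU euv ee'.
pose F x := if x == u then [set u; v] else [set x].
have xF x : x \in F x.
  by rewrite /F; case: eqP => [->|_]; rewrite !inE eqxx.
have vF : v \in F u by rewrite /F eqxx !inE eqxx orbT.
apply: (@K4_minor_trans _ _ _ _ _ F).
- move=> x xU; rewrite /F; case: eqP => _; last by rewrite sub1set !inE xU orbT.
  by apply/subsetP => z; rewrite !inE => /orP[]/eqP->; rewrite ?uU ?eqxx ?orbT.
- move=> x _; rewrite /F; case: eqP => _; last exact: cut_connected1.
  exact: cut_connected2.
- move=> x y z xU yU; rewrite /F.
  case: eqP => [->|_]; case: eqP => [->//|_]; rewrite !inE.
  + move=> /orP[]/eqP-> => [/eqP//|/eqP vy].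
    by rewrite vy yU in vU.
  + move=> /eqP-> /orP[]/eqP// xv.
    by rewrite -xv xU in vU.
  + by move=> /eqP-> /eqP.
- move=> x y xU yU /ee'[]// => [exy|[-> evy]|[-> exv]].
  + by exists x, y.
  + by exists v, y.
  + by exists x, v.
Qed.

Lemma K4_minor_clique (T : finType) (e : rel T) (U : {set T}) (a b c d : T) :
  symmetric e -> irreflexive e ->
  a \in U -> b \in U -> c \in U -> d \in U ->
  e a b -> e a c -> e a d -> e b c -> e b d -> e c d -> K4_minor_in U e.
Proof.
move=> esym eirr aU bU cU dU ab ac ad bc bd cd.
pose s (i : 'I_4) := nth a [:: a; b; c; d] i.
have es i j : i != j -> e (s i) (s j).
  rewrite -val_eqE /s; case: i j => i ilt [j jlt] /=.
  by move: i j ilt jlt => [|[|[|[|i]]]] [|[|[|[|j]]]] //= _ _ _; rewrite // esym.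
exists (fun i => [set s i]); split.
- by move=> [[|[|[|[|?]]]] //= ?]; rewrite sub1set.
- by move=> i; apply: cut_connected1.
- move=> i j x; rewrite !inE => /eqP-> /eqP sij.
  by apply/eqP/negPn/negP => /es; rewrite sij eirr.
- by move=> i j /es eij; exists (s i), (s j); rewrite !set11.
Qed.

Lemma add_edge_sym (T : finType) (e : rel T) (a b : T) :
  symmetric e -> symmetric (add_edge e a b).
Proof.
move=> esym x y; rewrite /add_edge esym; congr (_ || _).
by rewrite orbC; congr (_ || _); rewrite andbC.
Qed.

Lemma add_edge_irr (T : finType) (e : rel T) (a b : T) :
  irreflexive e -> a != b -> irreflexive (add_edge e a b).
Proof.
move=> eirr ab x; rewrite /add_edge eirr /=.
by case: eqP => [->|//] /=; rewrite ?(negPf ab) ?andbF.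
Qed.

(** * Dirac's theorem: minimum degree three forces a K4 minor *)

Definition nbhd_in (T : finType) (e : rel T) (U : {set T}) (x : T) : {set T} :=
  [set y in U | e x y].

Lemma card_setD2 (T : finType) (A : {set T}) (x y : T) :
  #|A| <= #|A :\ x :\ y| + 2.
Proof. by rewrite (cardsD1 x A) (cardsD1 y (A :\ x)); do 2!case: (_ \in _); lia. Qed.

Lemma cards3_split (T : finType) (A : {set T}) (x y : T) :
  #|A| = 3 -> x \in A -> y \in A -> x != y ->
  exists z, [/\ z != x, z != y & A = [set x; y; z]].
Proof.
move=> A3 xA yA xy.
have := cardsD1 x A; have := cardsD1 y (A :\ x).
rewrite A3 xA !inE eq_sym xy yA /= => c2 c3.
have /eqP/cards1P[z Az] : #|A :\ x :\ y| = 1 by lia.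
have : z \in A :\ x :\ y by rewrite Az set11.
rewrite !inE => /and3P[zy zx zA]; exists z; split=> //.
have yAx : y \in A :\ x by rewrite !inE eq_sym xy.
by rewrite -(setD1K xA) -(setD1K yAx) Az setUA.
Qed.

(** The merged vertex keeps the name [u]; the relation still mentions [v], which is to be removed
    from the vertex set. The test [x != y] discards the loop created at [u]. *)
Definition contraction (T : finType) (e : rel T) (u v : T) : rel T :=
  fun x y => (x != y) && [|| e x y, (x == u) && e v y | (y == u) && e x v].

Section Dirac.
Variables (T : finType) (e : rel T) (U : {set T}).
Hypotheses (esym : symmetric e) (eirr : irreflexive e).
Hypothesis deg3 : forall x, x \in U -> 3 <= #|nbhd_in e U x|.
(** The double negation suits a constructive induction: the hypothesis only ever serves to reach a
    contradiction. *)
Hypothesis minimal : forall (e' : rel T) (U' : {set T}),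
  symmetric e' -> irreflexive e' -> U' != set0 -> #|U'| < #|U| ->
  (forall x, x \in U' -> 3 <= #|nbhd_in e' U' x|) -> ~ ~ K4_minor_in U' e'.
Hypothesis noK4 : ~ K4_minor_in U e.

Let N x := nbhd_in e U x.

Let inN x y : (y \in N x) = (y \in U) && e x y. Proof. by rewrite inE. Qed.

(** Contracting [u v] costs a degree only at common neighbours, which can afford it by assumption.
    Were the merged vertex of degree at least three, minimality would give a K4 minor of the
    contracted graph, hence of the original one. *)
Lemma contraction_blocked u v : u \in U -> v \in U -> e u v ->
  (forall w, w \in U -> e u w -> e v w -> 4 <= #|N w|) ->
  #|(N u :|: N v) :\: [set u; v]| <= 2.
Proof.
move=> uU vU euv common; rewrite leqNgt; apply/negP => big.
have uv : u != v by apply: contraTneq euv => ->; rewrite eirr.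
pose e' := contraction e u v.
have uU' : u \in U :\ v by rewrite !inE uv.
apply: (@minimal e' (U :\ v)); last 1 first.
  move=> K4'; apply: noK4; rewrite -(setD1K vU).
  apply: (@K4_minor_contract _ e' e _ u v) => //; first by rewrite !inE eqxx.
  move=> x y _ _ /andP[_ /or3P[]] => [exy|/andP[/eqP-> evy]|/andP[/eqP-> exv]].
  - by constructor 1.
  - by constructor 2.
  - by constructor 3.
- move=> x y; rewrite /e' /contraction eq_sym (esym x y) (esym v y) (esym x v).
  by congr (_ && (_ || _)); rewrite orbC.
- by move=> x; rewrite /e' /contraction /= eqxx.
- by apply/set0Pn; exists u.
- by rewrite [X in _ < X](cardsD1 v) vU.
move=> w; rewrite !inE => /andP[wv wU].
have [->|wu] := eqVneq w u.
  apply: leq_trans big _; apply: subset_leq_card; apply/subsetP => y.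
  rewrite !inE /e' /contraction /= negb_or eqxx /= => /andP[/andP[yu yv]].
  by rewrite yv eq_sym yu /= => /orP[]/andP[-> ->]; rewrite ?orbT.
have [ewv|newv] := boolP (e w v); last first.
  apply: leq_trans (deg3 wU) _; apply: subset_leq_card; apply/subsetP => y.
  rewrite !inE /e' /contraction /= => /andP[-> ewy]; rewrite ewy !andbT /=.
  apply/andP; split; first by apply: contraNneq newv => <-.
  by apply: contraTneq ewy => ->; rewrite eirr.
have vN : v \in N w by rewrite inN vU.
have sN : N w :\ v \subset nbhd_in e' (U :\ v) w.
  apply/subsetP => y; rewrite !inE /e' /contraction /= => /and3P[-> -> ewy].
  by rewrite ewy /= andbT; apply: contraTneq ewy => <-; rewrite eirr.
have [ewu|newu] := boolP (e w u).
  have : 4 <= #|N w| by apply: common; rewrite // esym.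
  by rewrite (cardsD1 v) vN ltnS => /leq_trans; apply; apply: subset_leq_card.
(* The remaining case: [w] is adjacent to [v] but not to [u], and trades the neighbour [v] for
   [u]. *)
apply: leq_trans (deg3 wU) _; rewrite -/(N w) (cardsD1 v) vN.
have -> : true + #|N w :\ v| = #|u |: (N w :\ v)|.
  by rewrite cardsU1 !inE (negPf newu) !andbF.
apply: subset_leq_card; rewrite subUset sN andbT sub1set !inE uv uU.
by rewrite /e' /contraction /= wu eqxx ewv !orbT.
Qed.

(** If every common neighbour has degree at least four, [contraction_blocked] leaves at most two
    other neighbours for [u] and [v] together. Each has at least two by itself, so both have exactly
    this pair. *)
Lemma edge_cases u v : u \in U -> v \in U -> e u v ->
  (exists w, [/\ w \in N u, w \in N v & #|N w| = 3]) \/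
  (exists x y, [/\ x != y, N u = [set v; x; y] & N v = [set u; x; y]]).
Proof.
move=> uU vU euv.
have uv : u != v by apply: contraTneq euv => ->; rewrite eirr.
have [/existsP[w /and3P[wu wv /eqP w3]]|none] := boolP [exists w,
    [&& w \in N u, w \in N v & #|N w| == 3]]; first by left; exists w.
right; have small : #|(N u :|: N v) :\: [set u; v]| <= 2.
  apply: contraction_blocked => // w wU euw evw.
  have := deg3 wU; rewrite leq_eqVlt eq_sym => /orP[w3|//].
  by case/negP: none; apply/existsP; exists w; rewrite !inN wU euw evw.
set M := _ :\: _ in small.
have vNu : v \in N u by rewrite inN vU.
have uNv : u \in N v by rewrite inN uU esym.
have cu : 2 <= #|N u :\ v| by have := deg3 uU; rewrite -/(N u) (cardsD1 v) vNu.
have cv : 2 <= #|N v :\ u| by have := deg3 vU; rewrite -/(N v) (cardsD1 u) uNv.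
have Mu : N u :\ v = M.
  apply/eqP; rewrite eqEcard (leq_trans small cu) andbT.
  apply/subsetP => y; rewrite !inE negb_or => /and3P[-> -> euy].
  rewrite euy /= !andbT.
  by apply: contraTneq euy => ->; rewrite eirr.
have Mv : N v :\ u = M.
  apply/eqP; rewrite eqEcard (leq_trans small cv) andbT.
  apply/subsetP => y; rewrite !inE negb_or => /and3P[-> -> evy].
  rewrite evy orbT andbT /=.
  by apply: contraTneq evy => ->; rewrite eirr.
have /eqP/cards2P[x [y [xy Mxy]]] : #|M| = 2.
  by apply/eqP; rewrite eqn_leq small -Mu.
exists x, y; split=> //.
  by rewrite -(setD1K vNu) Mu Mxy setUA.
by rewrite -(setD1K uNv) Mv Mxy setUA.
Qed.

(** Otherwise [x] has just one further neighbour [x'], which is adjacent to neither [z] nor [q].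
    Then [x] and [x'] have no common neighbour and are not twins, against [edge_cases]. *)
Lemma twin_nbr_degree z q x y : z \in U -> q \in U ->
  z != q -> x != y -> N z = [set q; x; y] -> N q = [set z; x; y] ->
  ~~ e x y -> 4 <= #|N x|.
Proof.
move=> zU qU zq xy Nz Nq nxy.
have xNz : x \in N z by rewrite Nz !inE eqxx ?orbT.
have xNq : x \in N q by rewrite Nq !inE eqxx ?orbT.
move: (xNz) (xNq); rewrite !inN => /andP[xU ezx] /andP[_ eqx].
have := deg3 xU; rewrite leq_eqVlt eq_sym => /orP[/eqP x3|//].
have [|||x' [x'z x'q Nx]] := @cards3_split _ (N x) z q x3.
- by rewrite inN zU esym.
- by rewrite inN qU esym.
- by [].
have : x' \in N x by rewrite Nx !inE eqxx !orbT.
rewrite inN => /andP[x'U exx'].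
have x'x : x' != x by apply: contraTneq exx' => ->; rewrite eirr.
have x'y : x' != y by apply: contraNneq nxy => <-.
have nzx' : z \notin N x'.
  have : x' \notin N z by rewrite Nz !inE !negb_or x'q x'x.
  by rewrite !inN x'U zU esym.
have nqx' : q \notin N x'.
  have : x' \notin N q by rewrite Nq !inE !negb_or x'z x'x.
  by rewrite !inN x'U qU esym.
case: (edge_cases xU x'U exx') => [[w []]|[a [b [_ Nxab Nx'ab]]]].
  rewrite Nx 2!in_setU !in_set1 => /orP[/orP[]|] /eqP-> wx'.
  - by rewrite wx' in nzx'.
  - by rewrite wx' in nqx'.
  - by rewrite inN eirr andbF in wx'.
have : z \in N x by rewrite Nx !inE eqxx.
rewrite Nxab !in_setU !in_set1 eq_sym (negPf x'z) /= => zab.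
by case/negP: nzx'; rewrite Nx'ab !in_setU !in_set1 -orbA zab orbT.
Qed.

(** If [x] and [y] are adjacent, the four vertices form a K4. Otherwise both have degree at least
    four, and replacing [z] and [q] by an edge [x y] gives a smaller graph of minimum degree
    three. *)
Lemma no_twins z q x y : z \in U -> q \in U ->
  x != y -> N z = [set q; x; y] -> N q = [set z; x; y] -> False.
Proof.
move=> zU qU xy Nz Nq.
have : q \in N z by rewrite Nz !inE eqxx.
have : x \in N z by rewrite Nz !inE eqxx orbT.
have : y \in N z by rewrite Nz !inE eqxx orbT.
have : x \in N q by rewrite Nq !inE eqxx orbT.
have : y \in N q by rewrite Nq !inE eqxx orbT.
rewrite !inN => /andP[yU eqy] /andP[xU eqx] /andP[_ ezy] /andP[_ ezx] /andP[_ ezq].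
have zq : z != q by apply: contraTneq ezq => ->; rewrite eirr.
have [exy|nxy] := boolP (e x y).
  by apply: noK4; apply: (@K4_minor_clique _ _ _ z q x y).
have x4 := twin_nbr_degree zU qU zq xy Nz Nq nxy.
have y4 : 4 <= #|N y|.
  apply: (@twin_nbr_degree z q y x) => //; try by rewrite setUAC.
    by rewrite eq_sym.
  by rewrite esym.
have xz : x != z by apply: contraTneq ezx => ->; rewrite eirr.
have yz : y != z by apply: contraTneq ezy => ->; rewrite eirr.
have xq : x != q by apply: contraTneq eqx => ->; rewrite eirr.
have yq : y != q by apply: contraTneq eqy => ->; rewrite eirr.
pose U' := U :\ z :\ q; pose e' := add_edge e x y.
have e'sym : symmetric e' by apply: add_edge_sym.
have xU' : x \in U' by rewrite !inE xq xz.
have yU' : y \in U' by rewrite !inE yq yz.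
have zU' : z \notin U' by rewrite !inE eqxx andbF.
have UU' : z |: U' \subset U.
  by apply/subsetP => t; rewrite !inE => /orP[/eqP->//|/and3P[]].
(* Each of [x], [y] trades its two neighbours [z], [q] for the other one. *)
have trade a b : a \in U -> b \in U' -> 4 <= #|N a| -> e' a b -> ~~ e a b ->
    3 <= #|nbhd_in e' U' a|.
  move=> aU bU' a4 e'ab neab.
  have big : 2 <= #|N a :\ z :\ q|.
    by rewrite -(leq_add2r 2) (leq_trans a4) ?card_setD2.
  apply: (@leq_trans #|b |: (N a :\ z :\ q)|).
    by rewrite cardsU1 !inE (negPf neab) !andbF /= ltnS.
  apply: subset_leq_card; apply/subsetP => t; rewrite in_setU1.
  case/predU1P=> [->|]; first by rewrite inE bU'.
  by rewrite !inE => /and4P[-> -> -> eat]; rewrite /e' /add_edge eat.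
apply: (@minimal e' U') => //; last first.
(* The new graph is a minor of the old one: [q] is dropped, and contracting [z] onto [x] produces
   the edge [x y]. *)
- move=> K4'; apply: noK4; apply: (K4_minor_sub UU' (fun _ _ _ _ => id)).
  apply: (@K4_minor_contract _ e' e U' x z) => //; first by rewrite esym.
  move=> a b _ _ /or3P[]; first by constructor 1.
    by move=> /andP[/eqP-> /eqP->]; constructor 2.
  by move=> /andP[/eqP-> /eqP->]; constructor 3; rewrite esym.
- move=> t tU'; have tU : t \in U by move: tU'; rewrite !inE => /and3P[].
  have [->|tx] := eqVneq t x.
    by apply: (@trade _ y) => //; rewrite /e' /add_edge !eqxx orbT.
  have [->|ty] := eqVneq t y.
    by apply: (@trade _ x) => //; rewrite ?[e y x]esym // /e' /add_edge !eqxx !orbT.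
  have tNz : t \notin N z.
    by rewrite Nz !inE !negb_or tx ty !andbT; move: tU'; rewrite !inE => /and3P[].
  have tNq : t \notin N q.
    by rewrite Nq !inE !negb_or tx ty !andbT; move: tU'; rewrite !inE => /and3P[].
  apply: leq_trans (deg3 tU) _; apply: subset_leq_card; apply/subsetP => s.
  rewrite !inE => /andP[sU ets]; rewrite sU andbT /e' /add_edge ets andbT.
  apply/andP; split.
    by apply: contraNneq tNq => <-; rewrite inN tU esym.
  by apply: contraNneq tNz => <-; rewrite inN tU esym.
- rewrite /U' [X in _ < X](cardsD1 z) zU (cardsD1 q (U :\ z)) !inE eq_sym zq qU.
  by rewrite /= !add1n ltnW.
- by apply/set0Pn; exists x.
- exact: add_edge_irr.
Qed.

(** Apply [edge_cases] to the edge [z s]. Its ends are not twins, since [q] is adjacent to [z] but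
    not to [s]; so they have a common neighbour of degree three, and among the neighbours of [z]
    only [p] qualifies. *)
Lemma degree3_triangle z q p s t : z \in U -> q \in U ->
  N z = [set q; p; s] -> N q = [set z; p; t] -> q != s -> p != s -> s != t ->
  s \in N p /\ #|N p| = 3.
Proof.
move=> zU qU Nz Nq qs ps st.
have : s \in N z by rewrite Nz !inE eqxx !orbT.
rewrite inN => /andP[sU ezs].
have zs : z != s by apply: contraTneq ezs => ->; rewrite eirr.
have sNq : s \notin N q.
  by rewrite Nq !inE !negb_or eq_sym zs eq_sym ps.
have qNs : q \notin N s.
  by move: sNq; rewrite !inN sU qU esym.
case: (edge_cases zU sU ezs) => [[w []]|[a [b [_ Nzab Nsab]]]]; last first.
  have : q \in N z by rewrite Nz !inE eqxx.
  rewrite Nzab !in_setU !in_set1 (negPf qs) /= => qab.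
  by case/negP: qNs; rewrite Nsab !in_setU !in_set1 -orbA qab orbT.
rewrite Nz 2!in_setU !in_set1 => /orP[/orP[]|] /eqP-> wNs w3.
- by rewrite wNs in qNs.
- by split=> //; move: wNs; rewrite !inN sU esym => /andP[].
- by rewrite inN eirr andbF in wNs.
Qed.

(** Let [s] and [t] be the third neighbours of [z] and [q]. If they coincide, [z] and [q] are twins;
    otherwise [degree3_triangle], used from both sides, gives [p] degree three and yet four
    neighbours [z], [q], [s], [t]. *)
Lemma no_degree3_pair z q p : z \in U -> q \in U ->
  #|N z| = 3 -> #|N q| = 3 -> q \in N z -> p \in N z -> p \in N q -> False.
Proof.
move=> zU qU z3 q3 qNz pNz pNq.
have ezq : e z q by move: qNz; rewrite inN => /andP[].
have zq : z != q by apply: contraTneq ezq => ->; rewrite eirr.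
have zNq : z \in N q by rewrite inN zU esym.
have qp : q != p by apply: contraTneq pNq => <-; rewrite inN eirr andbF.
have zp : z != p by apply: contraTneq pNz => <-; rewrite inN eirr andbF.
have [s [sq sp Nz]] := cards3_split z3 qNz pNz qp.
have [t [tz tp Nq]] := cards3_split q3 zNq pNq zp.
have [st|st] := eqVneq s t.
  by apply: (@no_twins z q p s) => //; rewrite 1?eq_sym // Nq st.
have [sNp p3] : s \in N p /\ #|N p| = 3.
  by apply: (degree3_triangle zU qU Nz Nq); rewrite // eq_sym.
have [tNp _] : t \in N p /\ #|N p| = 3.
  by apply: (degree3_triangle qU zU Nq Nz); rewrite // eq_sym.
have : p \in U by move: pNz; rewrite inN => /andP[].
move=> pU; have zNp : z \in N p by move: pNz; rewrite !inN zU esym => /andP[].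
have qNp : q \in N p by move: pNq; rewrite !inN qU esym => /andP[].
have sz : s != z.
  have : s \in N z by rewrite Nz !inE eqxx !orbT.
  by apply: contraTneq => ->; rewrite inN eirr andbF.
have tq : t != q.
  have : t \in N q by rewrite Nq !inE eqxx !orbT.
  by apply: contraTneq => ->; rewrite inN eirr andbF.
have : #|[set z; q; s; t]| <= #|N p|.
  by apply: subset_leq_card; rewrite !subUset !sub1set zNp qNp sNp tNp.
rewrite p3 -!setUA !cardsU1 cards1 !inE !negb_or.
by rewrite zq eq_sym sz eq_sym tz eq_sym sq eq_sym tq st.
Qed.

(** With twins excluded, every edge has a common neighbour of degree three. One edge yields a vertex
    [z] of degree three, and an edge at [z] then yields a triangle with two such vertices. *)
Lemma Dirac_step : U = set0.
Proof.
apply/eqP/negPn/negP => /set0Pn[u uU].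
have nbr x : x \in U -> exists2 y, y \in U & e x y.
  move=> /deg3; rewrite -/(N x); have [->|/set0Pn[y]] := eqVneq (N x) set0.
    by rewrite cards0.
  by rewrite inN => /andP[]; exists y.
have [z zU z3] : exists2 z, z \in U & #|N z| = 3.
  have [v vU euv] := nbr u uU.
  case: (edge_cases uU vU euv) => [[w []]|[x [y [xy Nu Nv]]]].
    by rewrite inN => /andP[]; exists w.
  by case: (no_twins uU vU xy Nu Nv).
have [p pU ezp] := nbr z zU.
case: (edge_cases zU pU ezp) => [[q [qNz qNp q3]]|[x [y [xy Nz Np]]]].
  have qU : q \in U by move: qNz; rewrite inN => /andP[].
  apply: (@no_degree3_pair z q p) => //; first by rewrite inN pU.
  by move: qNp; rewrite !inN pU esym => /andP[].
exact: (no_twins zU pU xy Nz Np).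
Qed.

End Dirac.

(** Strong induction on the size of [U], for all [e] at once, because contraction and edge addition
    change the relation. *)
Theorem ex_degree_le2 (T : finType) (e : rel T) (U : {set T}) :
  symmetric e -> irreflexive e -> U != set0 -> ~ K4_minor_in U e ->
  exists2 x, x \in U & #|nbhd_in e U x| <= 2.
Proof.
move: {2}#|U|.+1 (ltnSn #|U|) => n.
elim: n e U => // n IHn e U ltUn esym eirr U0 noK4.
have [/exists_inP[x]|none] := boolP [exists x in U, #|nbhd_in e U x| <= 2].
  by exists x.
have deg3 x : x \in U -> 3 <= #|nbhd_in e U x|.
  move=> xU; rewrite ltnNge; apply/negP => x2; case/negP: none.
  by apply/exists_inP; exists x.
case/eqP: U0; apply: (Dirac_step esym eirr deg3 _ noK4).
move=> e' U' e'sym e'irr U'0 ltU' deg3' noK4'.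
have [x xU' x2] := IHn e' U' (leq_trans ltU' ltUn) e'sym e'irr U'0 noK4'.
by have := deg3' x xU'; rewrite ltnNge x2.
Qed.

(** * 2-trees *)

(** The base is an edge rather than a triangle, so that peeling off vertices of low degree can go
    down to two vertices. *)
Inductive two_tree (T : finType) : {set T} -> rel T -> Prop :=
| TwoTreeEdge a b : a != b -> two_tree [set a; b] (add_edge (fun _ _ => false) a b)
| TwoTreeAdd W h w a b : two_tree W h -> w \notin W -> h a b ->
    two_tree (w |: W) (add_edge (add_edge h w a) w b).

Lemma two_tree_graph (T : finType) (W : {set T}) (h : rel T) : two_tree W h ->
  [/\ symmetric h, irreflexive h & forall x y, h x y -> x \in W /\ y \in W].
Proof.
elim=> {W h} [a b ab|W h w a b _ [hsym hirr hW] wW hab].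
  split; [exact: add_edge_sym | exact: add_edge_irr |].
  by move=> x y /or3P[]// /andP[/eqP-> /eqP->]; rewrite !inE !eqxx orbT.
have [aW bW] := hW _ _ hab.
have wa : w != a by apply: contraNneq wW => ->.
have wb : w != b by apply: contraNneq wW => ->.
split; [by do 2!apply: add_edge_sym | by do 2!(apply: add_edge_irr => //) |].
move=> x y; rewrite /add_edge !inE => /orP[/or3P[/hW[-> ->]||]|/orP[]];
  rewrite ?orbT // => /andP[/eqP-> /eqP->]; by rewrite ?aW ?bW eqxx ?orbT.
Qed.

Lemma two_tree_nbr (T : finType) (W : {set T}) (h : rel T) x : two_tree W h ->
  x \in W -> exists y, h x y.
Proof.
elim=> {W h} [a b ab|W h w a b _ IH wW hab].
  rewrite !inE => /orP[]/eqP->; [exists b | exists a];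
    by rewrite /add_edge !eqxx ?orbT.
rewrite !inE => /orP[/eqP->|/IH[y hxy]].
  by exists b; rewrite /add_edge !eqxx ?orbT.
by exists y; rewrite /add_edge hxy.
Qed.

Lemma two_tree_triangle (T : finType) (W : {set T}) (h : rel T) x :
  two_tree W h -> 3 <= #|W| -> x \in W ->
  exists y z, [/\ h x y, h x z & h y z].
Proof.
elim=> {W h} [a b ab|W h w a b tW IH wW hab]; first by rewrite cards2 ab.
have [hsym hirr hW] := two_tree_graph tW; have [aW bW] := hW _ _ hab.
set h' := add_edge _ w b.
have h'wa : h' w a by rewrite /h' /add_edge !eqxx !orbT.
have h'aw : h' a w by rewrite /h' /add_edge !eqxx !orbT.
have h'wb : h' w b by rewrite /h' /add_edge !eqxx !orbT.
have h'bw : h' b w by rewrite /h' /add_edge !eqxx !orbT.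
have hh' u v : h u v -> h' u v by rewrite /h' /add_edge => ->.
rewrite !inE => W3 /predU1P[->|xW]; first by exists a, b; split=> //; apply: hh'.
have [big|small] := leqP 3 #|W|.
  by have [y [z [xy xz yz]]] := IH big xW; exists y, z; split; apply: hh'.
have ab : a != b by apply: contraTneq hab => ->; rewrite hirr.
(* Here [W] is only the initial edge, whose ends get their triangle from the new vertex [w]. *)
have /eqP WE : [set a; b] == W.
  by rewrite eqEcard subUset !sub1set aW bW cards2 ab.
move: xW; rewrite -WE !inE => /orP[]/eqP->.
  by exists w, b; split=> //; apply: hh'.
by exists w, a; split=> //; apply: hh'; rewrite hsym.
Qed.

(** Greedy colouring along the construction: a new vertex sees two colours, so a third is free. *)
Lemma two_tree_coloring (T : finType) (W : {set T}) (h : rel T) :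
  two_tree W h -> exists c : T -> 'I_3, forall x y, h x y -> c x != c y.
Proof.
elim=> {W h} [a b ab|W h w a b tW [c hc] wW hab].
  exists (fun x => if x == a then inord 0 else inord 1) => x y.
  have ba : b == a = false by rewrite eq_sym (negPf ab).
  by move=> /or3P[]// /andP[/eqP-> /eqP->]; rewrite ba eqxx -val_eqE /= !inordK.
have [hsym hirr hW] := two_tree_graph tW; have [aW bW] := hW _ _ hab.
have [k ka kb] : exists2 k : 'I_3, k != c a & k != c b.
  have : [set c a; c b] != [set: 'I_3].
    by apply: contraTneq isT => cE; have := cards2 (c a) (c b);
       rewrite cE cardsT card_ord; case: (_ != _).
  rewrite -subTset => /subsetPn[k _]; rewrite !inE negb_or => /andP[].
  by exists k.
exists (fun x => if x == w then k else c x) => x y.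
have neq z : z \in W -> z == w = false by move=> zW; apply: contraNF wW => /eqP <-.
rewrite /add_edge => /orP[/or3P[hxy||]|/orP[]].
- by have [xW yW] := hW _ _ hxy; rewrite !neq //; apply: hc.
all: move=> /andP[/eqP-> /eqP->]; rewrite eqxx ?neq //; by rewrite eq_sym.
Qed.

(* A bag containing [w] must contain a neighbour [c] of [w], for otherwise it is
   [[set w]] and has at most two neighbouring bags; contract [w] onto [c]. *)
Lemma two_tree_K4_free (T : finType) (W : {set T}) (h : rel T) :
  two_tree W h -> ~ K4_minor_in W h.
Proof.
elim=> {W h} [a b ab [B [sB cB dB aB]]|W h w a b tW IH wW hab].
  (* On two vertices, a bag is determined by whether it contains [a]; four bags cannot inject into
     [bool]. *)
  have inj : injective (fun i => a \in B i).
    move=> i j /= ij; have [/set0Pn[x xi] _] := cB i.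
    have [/set0Pn[y yj] _] := cB j.
    have := subsetP (sB i) _ xi; have := subsetP (sB j) _ yj; rewrite !inE.
    have [ai|nai] := boolP (a \in B i).
      by move=> _ _; apply: (dB i j a) => //; rewrite -ij.
    move=> /orP[/eqP ya|/eqP yb]; first by rewrite ij -ya yj in nai.
    move=> /orP[/eqP xa|/eqP xb]; first by rewrite -xa xi in nai.
    by apply: (dB i j b); [rewrite -xb | rewrite -yb].
  by have := leq_card _ inj; rewrite card_ord card_bool.
have [hsym hirr hW] := two_tree_graph tW; have [aW bW] := hW _ _ hab.
set h' := add_edge _ w b => -[B [sB cB dB aB]]; apply: IH.
have h'sym : symmetric h' by do 2!apply: add_edge_sym.
have wa : a != w by apply: contraNneq wW => <-.
have wb : b != w by apply: contraNneq wW => <-.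
have h'w y : h' w y -> y = a \/ y = b.
  rewrite /h' /add_edge eqxx (eq_sym w a) (eq_sym w b) (negPf wa) (negPf wb) /=.
  rewrite !orbF => /orP[/orP[/hW[]|/eqP->]|/eqP->]; [|by left|by right].
  by rewrite (negPf wW).
have h'h x y : x != w -> y != w -> h' x y -> h x y.
  by rewrite /h' /add_edge => /negPf-> /negPf->; rewrite !andbF /= !orbF.
have [c cab cB'] : exists2 c, c = a \/ c = b & forall i, w \in B i -> c \in B i.
  have [/existsP[i wi]|none] := boolP [exists i, w \in B i]; last first.
    exists a => [|i wi]; first by left.
    by case/negP: none; apply/existsP; exists i.
  suff [c cab ci] : exists2 c, c = a \/ c = b & c \in B i.
    by exists c => // j wj; rewrite -(dB _ _ _ wi wj).
  have [/subsetPn[y yi yw]|wB] := boolP (~~ (B i \subset [set w])).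
    have [_ /(_ [set w] w y wi (set11 w) yi yw)] := cB i.
    by move=> [u [v [_ /set1P-> vi _ /h'w]]]; exists v.
  have nbr j : j != i -> a \in B j \/ b \in B j.
    rewrite eq_sym => /aB[x [y [xi yj]]].
    move/negPn/subsetP/(_ _ xi): wB => /set1P-> /h'w[] <-; by [left|right].
  (* Each of the three other bags contains [a] or [b], so again membership of [a] tells them apart,
     which is impossible for three bags. *)
  have : {in predC1 i &, injective (fun j => a \in B j)}.
    move=> j k /= /nbr jab /nbr kab jk.
    have [aj|naj] := boolP (a \in B j).
      by apply: (dB j k a) => //; rewrite -jk.
    case: jab => [aj|bj]; first by rewrite aj in naj.
    case: kab => [ak|bk]; first by rewrite jk ak in naj.
    exact: (dB j k b).
  move=> inj; have := leq_card_in _ _ inj.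
  by rewrite cardC1 card_ord card_bool.
have cW : c \in W by case: cab => ->.
have cw : c != w by case: cab => ->.
(* The retraction contracting [w] onto [c]. It maps every bag into itself, so the images stay
   disjoint. *)
pose f x := if x == w then c else x.
have fB i x : x \in B i -> f x \in B i.
  by rewrite /f; case: eqP => [-> /cB'|].
have h'c y : h' w y -> c = f y \/ h c (f y).
  move=> h'wy; have yw : y != w by case: (h'w _ h'wy) => ->.
  rewrite /f (negPf yw); case: (h'w _ h'wy) => ->; case: cab => ->; auto.
  by right; rewrite hsym.
have fh x y : h' x y -> f x = f y \/ h (f x) (f y).
  have [->|xw] := eqVneq x w; first by rewrite {1 3}/f eqxx; apply: h'c.
  have [->|yw] := eqVneq y w.
    rewrite h'sym {2 4}/f eqxx => /h'c[->|]; first by left.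
    by rewrite hsym; right.
  by rewrite /f (negPf xw) (negPf yw) => /h'h; right; auto.
exists (fun i => f @: B i); split.
- move=> i; apply/subsetP => _ /imsetP[x xi ->].
  have := subsetP (sB i) _ xi; rewrite /f !inE.
  by case: eqP.
- move=> i; have [/set0Pn[z zi] cutB] := cB i; split.
    by apply/set0Pn; exists (f z); apply: imset_f.
  move=> S _ _ /imsetP[x xi ->] xS /imsetP[y yi ->] yS.
  have [||u [v]] := cutB (f @^-1: S) x y xi _ yi; rewrite ?inE //.
  move=> [ui uS vi vS /fh[uv|huv]]; first by rewrite -uv uS in vS.
  by exists (f u), (f v); split=> //; apply: imset_f.
- move=> i j _ /imsetP[x xi ->] /imsetP[y yj xy].
  by apply: (dB i j (f x)); [apply: fB | rewrite xy; apply: fB].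
- move=> i j nij; have [x [y [xi yj /fh[xy|hxy]]]] := aB i j nij.
    case/eqP: nij; apply: (dB i j (f x)); first exact: fB.
    by rewrite xy; apply: fB.
  by exists (f x), (f y); split=> //; apply: imset_f.
Qed.

(** Induction on the size: remove a vertex [v] of degree at most two, embed the rest in a 2-tree,
    and attach [v] to an edge of it that covers the neighbours of [v]. *)
Theorem K4_free_sub_two_tree (T : finType) (e : rel T) (U : {set T}) :
  symmetric e -> irreflexive e -> 2 <= #|U| -> ~ K4_minor_in U e ->
  exists2 h, two_tree U h & forall x y, x \in U -> y \in U -> e x y -> h x y.
Proof.
move: {2}#|U| (leqnn #|U|) => n.
elim: n e U => [|n IHn] e U leUn esym eirr U2 noK4.
  by rewrite leqNgt (leq_trans _ U2) in leUn.
have [small|big] := leqP #|U| 2.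
  have /eqP/cards2P[a [b [ab UE]]] : #|U| = 2 by apply/eqP; rewrite eqn_leq small.
  exists (add_edge (fun _ _ => false) a b); first by rewrite UE; constructor.
  move=> x y; rewrite UE !inE /add_edge /= => /orP[]/eqP-> /orP[]/eqP->;
    by rewrite ?eirr ?eqxx ?orbT.
have U0 : U != set0 by rewrite -card_gt0; apply: leq_trans big.
have [v vU v2] := ex_degree_le2 esym eirr U0 noK4.
have U'n : #|U :\ v| <= n by move: leUn; rewrite (cardsD1 v) vU.
have U'2 : 2 <= #|U :\ v| by move: big; rewrite (cardsD1 v) vU.
have vU' : v \notin U :\ v by rewrite !inE eqxx.
suff [h [a [b [tU' eh hab Nv]]]] : exists h a b, [/\ two_tree (U :\ v) h,
    forall x y, x \in U :\ v -> y \in U :\ v -> e x y -> h x y, h a b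
    & nbhd_in e U v \subset [set a; b]].
  exists (add_edge (add_edge h v a) v b).
    by rewrite -(setD1K vU); constructor.
  have hv y : y \in U -> e v y -> y = a \/ y = b.
    move=> yU evy; have /(subsetP Nv) : y \in nbhd_in e U v by rewrite inE yU.
    by rewrite !inE => /orP[]/eqP; auto.
  move=> x y xU yU exy; have [xv|xv] := eqVneq x v.
    rewrite xv in exy *; rewrite /add_edge eqxx.
    by case: (hv y yU exy) => ->; rewrite eqxx !orbT.
  have [yv|yv] := eqVneq y v.
    rewrite yv esym in exy *; rewrite /add_edge eqxx.
    by case: (hv x xU exy) => ->; rewrite eqxx !orbT.
  by rewrite /add_edge eh // !inE ?xv ?yv.
have noK4' : ~ K4_minor_in (U :\ v) e.
  move=> K4; apply: noK4; apply: K4_minor_sub K4 => //.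
  exact: subD1set.
move: v2; rewrite leq_eqVlt => /orP[/cards2P[a [b [ab Nv]]]|v1].
  have : a \in nbhd_in e U v by rewrite Nv !inE eqxx.
  have : b \in nbhd_in e U v by rewrite Nv !inE eqxx orbT.
  rewrite !inE => /andP[bU evb] /andP[aU eva].
  have av : a != v by apply: contraTneq eva => ->; rewrite eirr.
  have bv : b != v by apply: contraTneq evb => ->; rewrite eirr.
  (* The two neighbours of [v] must be adjacent in the 2-tree, so their edge is added first. No K4
     minor appears, as contracting [v] onto [a] creates this edge. *)
  have [|||h tU' eh] := IHn (add_edge e a b) (U :\ v) U'n _ _ U'2.
  - exact: add_edge_sym.
  - exact: add_edge_irr.
  - move=> K4; apply: noK4; rewrite -(setD1K vU).
    apply: (@K4_minor_contract _ _ _ _ a v) K4 => //.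
    + by rewrite !inE av.
    + by rewrite esym.
    move=> x y _ _ /or3P[]; first by constructor 1.
      by move=> /andP[/eqP-> /eqP->]; constructor 2.
    by move=> /andP[/eqP-> /eqP->]; constructor 3; rewrite esym.
  exists h, a, b; split=> //; last by rewrite Nv.
    by move=> x y xU yU exy; apply: eh => //; rewrite /add_edge exy.
  by apply: eh; rewrite ?inE ?av ?bv // /add_edge !eqxx orbT.
(* With at most one neighbour, any edge of [h] at that neighbour will do; an isolated [v] may use
   any edge. *)
have [//|h tU' eh] := IHn e (U :\ v) U'n esym eirr U'2.
have [a aU' Nv] : exists2 a, a \in U :\ v & nbhd_in e U v \subset [set a].
  have [N0|/set0Pn[a aN]] := eqVneq (nbhd_in e U v) set0.
    have /card_gt0P[a aU'] : 0 < #|U :\ v| by apply: leq_trans U'2.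
    by exists a => //; rewrite N0 sub0set.
  exists a.
    move: aN; rewrite !inE => /andP[-> eva]; rewrite andbT.
    by apply: contraTneq eva => ->; rewrite eirr.
  have /eqP <- : [set a] == nbhd_in e U v.
    by rewrite eqEcard sub1set aN cards1.
  exact: subxx.
have [b hab] := two_tree_nbr tU' aU'.
exists h, a, b; split=> //; apply: subset_trans Nv _.
by rewrite sub1set !inE eqxx.
Qed.

(** If the 2-tree [h] containing [e] had an edge not in [e], adding that edge to [e] would create a
    K4 minor by maximality; but the enlarged graph still lies in [h], which has none. *)
Lemma maximal_K4_free_two_tree (T : finType) (e : rel T) :
  simple_graph e -> 2 <= #|T| -> maximal_K4_minor_free e ->
  exists2 h, two_tree [set: T] h & h =2 e.
Proof.
move=> [esym eirr] T2 [eK4 emax].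
have [||h tT eh] := @K4_free_sub_two_tree _ e [set: T] esym eirr.
- by rewrite cardsT.
- by move=> /K4_minor_inT.
exists h => // x y; apply/idP/idP => [hxy|]; last exact: eh.
apply/negPn/negP => nexy; have [hsym hirr _] := two_tree_graph tT.
have xy : x != y by apply: contraTneq hxy => ->; rewrite hirr.
apply: (two_tree_K4_free tT); have /K4_minor_inT := emax x y xy nexy.
apply: K4_minor_sub => // u v _ _ /or3P[|/andP[/eqP-> /eqP->]//|].
  exact: eh.
by move=> /andP[/eqP-> /eqP->]; rewrite hsym.
Qed.

(** * Double domination *)

Lemma double_domination_number_le (T : finType) (e : rel T) (S : {set T}) :
  double_dominating e S -> double_domination_number e <= #|S|.
Proof.
move=> dS; rewrite /double_domination_number.
have : S \in index_enum {set T} by apply: mem_index_enum.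
elim: (index_enum _) => //= A r IHr; rewrite inE big_cons.
case/predU1P=> [<-|/IHr leS]; first by rewrite dS geq_minl.
by case: ifP => // _; apply: leq_trans leS; apply: geq_minr.
Qed.

(** The triangle at [x] lies in the closed neighbourhood of [x] and has three distinct colours, so
    at most one of its vertices is lost with colour [k]. *)
Lemma complement_class_double_dominating (T : finType) (e : rel T)
    (c : T -> 'I_3) (k : 'I_3) :
  symmetric e -> (forall x y, e x y -> c x != c y) ->
  (forall x, exists y z, [/\ e x y, e x z & e y z]) ->
  double_dominating e [set x | c x != k].
Proof.
move=> esym ec tri; apply/forallP => x; have [y [z [xy xz yz]]] := tri x.
have := ec _ _ xy; have := ec _ _ xz; have := ec _ _ yz.
have neq u v : e u v -> u != v.
  by move=> /ec; apply: contraNneq => ->.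
set A := _ :&: _ => cyz cxz cxy.
have two u v : e u v -> u \in A -> v \in A -> 2 <= #|A|.
  move=> /neq uv uA vA; have : #|[set u; v]| <= #|A|.
    by apply: subset_leq_card; rewrite subUset !sub1set uA vA.
  by rewrite cards2 uv.
have xA : (x \in A) = (c x != k) by rewrite !inE eqxx.
have yA : (y \in A) = (c y != k) by rewrite !inE xy orbT.
have zA : (z \in A) = (c z != k) by rewrite !inE xz orbT.
have [cx|cx] := eqVneq (c x) k.
  by apply: (two y z); rewrite ?yA ?zA // -cx eq_sym.
have [cy|cy] := eqVneq (c y) k.
  by apply: (two x z); rewrite ?xA ?zA // -cy eq_sym.
by apply: (two x y); rewrite ?xA ?yA.
Qed.

(** Averaging: if no [k] worked, each of the three classes would have fewer than a third of the
    vertices, and they could not add up to [#|T|]. *)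
Lemma ex_large_class (T : finType) (c : T -> 'I_3) :
  exists k, 3 * #|[set x | c x != k]| <= 2 * #|T|.
Proof.
have total : \sum_(k < 3) #|[set x | c x == k]| = #|T|.
  rewrite -sum1_card (partition_big c predT) //=.
  by apply: eq_bigr => k _; rewrite sum1dep_card.
have compl k : #|[set x | c x == k]| + #|[set x | c x != k]| = #|T|.
  rewrite -(cardsC [set x | c x == k]); congr (_ + #|pred_of_set _|).
  by apply/setP => x; rewrite !inE.
case: (pickP (fun k => 3 * #|[set x | c x != k]| <= 2 * #|T|)) => [k|none].
  by exists k.
exfalso; move: total; rewrite !big_ord_recl big_ord0.
have low k : 3 * #|[set x | c x == k]| < #|T|.
  by have := compl k; have /negbT := none k; rewrite -ltnNge; lia.
by have := low ord0; have := low (lift ord0 ord0);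
   have := low (lift ord0 (lift ord0 ord0)); lia.
Qed.

Theorem theorem3p2 (T : finType) (e : rel T) :
  simple_graph e -> 3 <= #|T| -> maximal_K4_minor_free e ->
  double_domination_number e <= (2 * #|T|) %/ 3.
Proof.
move=> eG T3 emax.
have [h tT he] := maximal_K4_free_two_tree eG (ltnW T3) emax.
have [c hc] := two_tree_coloring tT.
have [k small] := ex_large_class c.
apply: (@leq_trans #|[set x | c x != k]|); last by rewrite leq_divRL // mulnC.
apply: double_domination_number_le; apply: complement_class_double_dominating.
- by case: eG.
- by move=> x y; rewrite -he; apply: hc.
move=> x; have [||y [z]] := @two_tree_triangle _ _ _ x tT; rewrite ?cardsT ?inE //.
by exists y, z; rewrite -!he.
Qed.
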